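(* Let $\varepsilon>0$, let $k\ge1$ and $i$ be integers, and let $\gamma_s:[0,1]\to[0,1]$ be twice continuously differentiable with $\gamma_s(0)=0$, $\gamma_s(1)=1$ and $\gamma_s'(0)=\gamma_s'(1)=0$. Extend $\gamma_s$ to $\mathbb{R}$ by $\gamma_s(x)=0$ for $x<0$ and $\gamma_s(x)=1$ for $x>1$. Let $\mathcal{J}=\{i,\dots,i+k\}$ and $\mathcal{J}^+=\{i-2,\dots,i+k+1\}$, and define $\gamma_{\mathcal{J}}:\mathcal{J}^+\to[0,1]$ by $\gamma_{\mathcal{J}}(\xi)=\gamma_s\left(\frac{\xi-i}{k}\right)$. Let $\bar\gamma_{\mathcal{J}}(\xi)=\frac{\gamma_{\mathcal{J}}(\xi)+\gamma_{\mathcal{J}}(\xi-1)}{2}$. Then for all $p\in[1,\infty]$, $$\|\Delta^2\bar\gamma_{\mathcal{J}}\|_{\ell^p_\varepsilon(\mathcal{J})}\le\|\Delta^2\gamma_{\mathcal{J}}\|_{\ell^p_\varepsilon(\mathcal{J})}\le\varepsilon^{\frac1p}k^{\frac1p-2}\left\|\frac{d^2\gamma_s}{dx^2}\right\|_{L^p([0,1])}.$$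
   Context: $\Delta^2v_\xi=v_{\xi+1}-2v_\xi+v_{\xi-1}$. For a finite set $\mathcal{J}\subset\mathbb{Z}$, $\|v\|_{\ell^p_\varepsilon(\mathcal{J})}=(\varepsilon\sum_{\xi\in\mathcal{J}}|v_\xi|^p)^{1/p}$ for $p\in[1,\infty)$ and $\|v\|_{\ell^\infty_\varepsilon(\mathcal{J})}=\max_{\xi\in\mathcal{J}}|v_\xi|$; the convention $1/p=0$ is used for $p=\infty$. *)

(* Defs.v *)
From mathcomp Require Export all_boot all_order all_algebra finmap.
From mathcomp Require Export all_classical all_reals all_analysis.
Export Order.TTheory GRing.Theory Num.Theory.
Export numFieldNormedType.Exports.

Set Implicit Arguments.
Unset Strict Implicit.
Unset Printing Implicit Defensive.

Global Open Scope classical_set_scope.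
Global Open Scope ring_scope.

(* One-dimensional calculus on a set A of reals: difference quotients only use
   points of A, so the derivative is one-sided at the endpoints of an interval
   and does not depend on the values of the function outside A. *)
Definition diff_quot (R : realType) (f : R -> R) (x y : R) : R :=
  (f y - f x) / (y - x).

Definition derivable_in (R : realType) (A : set R) (f : R -> R) (x : R) : Prop :=
  cvg (diff_quot f x @ within A x^').

(* Meaningful when f is derivable_in A at x; an unspecified value otherwise. *)
Definition derive_in (R : realType) (A : set R) (f : R -> R) (x : R) : R :=
  lim (diff_quot f x @ within A x^').

Definition derive2_in (R : realType) (A : set R) (f : R -> R) : R -> R :=
  derive_in A (derive_in A f).

Definition C2_in (R : realType) (A : set R) (f : R -> R) : Prop :=
  [/\ {in A, forall x, derivable_in A f x},
      {in A, forall x, derivable_in A (derive_in A f) x},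
      {within A, continuous f},
      {within A, continuous (derive_in A f)} &
      {within A, continuous (derive2_in A f)}].

(* Norm of L^p(A), p in [1, +oo], for a function on A: restricting f to A means
   extending it by 0, which changes neither the integral of |f|^p over A nor,
   as |f| >= 0, its essential supremum over A (for a non-negligible A). *)
Definition LpNorm (R : realType) (A : set R) (p : \bar R) (f : R -> R) : \bar R :=
  'N[@lebesgue_measure R]_p[EFin \o (f \_ A)].

(* The convention 1/p = 0 for p = +oo. *)
Definition inv_exponent (R : realType) (p : \bar R) : R :=
  if p is r%:E then r^-1 else 0.

(* The value at p = -oo is a dummy: the exponents are in [1, +oo].  The maximum
   may start from 0 since all terms are nonnegative. *)
Definition ell_norm (R : realType) (eps : R) (p : \bar R) (J : {fset int})
    (v : int -> R) : R :=
  match p with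
  | r%:E => (eps * \sum_(xi <- J) `|v xi| `^ r) `^ r^-1
  | +oo%E => \big[Num.max/0]_(xi <- J) `|v xi|
  | -oo%E => 0
  end.

Definition Delta2 (R : realType) (v : int -> R) (xi : int) : R :=
  v (xi + 1) - 2 * v xi + v (xi - 1).

Definition int_range (i : int) (k : nat) : {fset int} :=
  [fset (i + n%:Z)%R | n in iota 0 k.+1]%fset.

Definition extend01 (R : realType) (f : R -> R) (x : R) : R :=
  if x < 0 then 0 else if 1 < x then 1 else f x.

(* Given on all of int; Delta2 of gammaJ and of gammaJ_bar at the points of
   J = {i, ..., i + k} only involves the values of gammaJ on
   J^+ = {i - 2, ..., i + k + 1}. *)
Definition gammaJ (R : realType) (gamma_s : R -> R) (i : int) (k : nat)
    (xi : int) : R :=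
  extend01 gamma_s ((xi - i)%:~R / k%:R).

Definition gammaJ_bar (R : realType) (gamma_s : R -> R) (i : int) (k : nat)
    (xi : int) : R :=
  (gammaJ gamma_s i k xi + gammaJ gamma_s i k (xi - 1)) / 2.

(* Main.v *)
Require Import Defs.
From mathcomp Require Import ring lra zify measurable_realfun ess_sup_inf.

(** Write h = 1/k, x_n = n/k and g for the second derivative of the profile.

    The second difference of the averaged profile at xi is the mean of the
    second differences of the profile at xi and xi - 1, and the one at i - 1
    vanishes because the profile is 0 up to i.  Convexity of |t|^p, or the
    triangle inequality for the maximum, then gives the first inequality
    ([ell_norm_gammaJ_bar_le]).

    For the second one, the second difference at x_n is the sum of the Taylor
    remainder of order 1 from x_n to x_(n+1) and of the one from x_n to
    x_(n-1); as the profile is constant with zero slope outside [0, 1], at n = 0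
    and n = k one of the two is simply absent ([Delta2_gammaJ_remainders]).  A
    remainder is h^2/2 times a weighted mean of g over a cell, so that Jensen's
    inequality bounds its p-th power by the remainder of a function whose second
    derivative is |g|^p.

    Jensen's inequality is proved here without integrals: if the second
    derivative of H is |g|^p and |t|^p >= c + m t is a tangent line, then
    H - m gamma - c t^2 / 2 has a nonnegative second derivative, hence
    nonnegative Taylor remainders ([remainders_affine_lb],
    [remainders_powR_le]).  The two remainders of H on a cell add up to h times
    the increment of H' over the cell; summing over the cells telescopes to
    h (H'(1) - H'(0)), which is h times the integral of |g|^p over [0, 1]
    ([sum_Delta2_powR_le], [continuous_antiderivative]).  For p = +oo the same
    comparison with the constants -M and M bounds both remainders by M h^2 / 2
    ([Delta2_norm_le]), and by continuity of g an essential bound M holds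
    everywhere in the open interval ([LpNorm_pinfty]). *)

Set Implicit Arguments.
Unset Strict Implicit.

(** * Antiderivatives on an interval *)

Section antiderivatives.
Context {R : realType}.
Implicit Types (f g F G : R -> R) (a b x y : R).

Lemma cvg_addr_dnbhs x c : h + c @[h --> x^'] --> (x + c)^'.
Proof.
move=> P [e /= e0 Pe]; exists e => //= h he hx; apply: Pe => /=.
  by move: he; rewrite /ball/= opprD addrACA subrr addr0.
by apply: contra hx => /eqP/addIr ->.
Qed.

(** The change of variable y = h + x relates difference quotients at x to the
    quotients that define the derivative. *)
Lemma diff_quot_cvgP F x (l : R) :
  diff_quot F x @ x^' --> l <-> h^-1 * (F (h + x) - F x) @[h --> 0^'] --> l.
Proof.
split=> H.
  have -> : (fun h : R => h^-1 * (F (h + x) - F x)) =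
            diff_quot F x \o (fun h => h + x).
    by apply/funext => h; rewrite /diff_quot /= addrK mulrC.
  have := @cvg_addr_dnbhs 0 x; rewrite add0r => s; exact: cvg_comp s H.
have -> : diff_quot F x =
    (fun h : R => h^-1 * (F (h + x) - F x)) \o (fun y => y - x).
  by apply/funext => y; rewrite /diff_quot /= subrK mulrC.
have := @cvg_addr_dnbhs x (- x); rewrite subrr => s; exact: cvg_comp s H.
Qed.

Lemma derivable_diff_quot F x :
  derivable F x 1 -> diff_quot F x @ x^' --> derive1 F x.
Proof.
move=> dF; apply/diff_quot_cvgP.
have e : (fun h => h^-1 *: (F (h *: 1 + x) - F x)) =
         (fun h : R => h^-1 * (F (h + x) - F x)).
  by apply/funext => h; rewrite [_ *: 1]mulr1.
by move: dF; rewrite /derivable e.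
Qed.

(** F is C^0 up to the endpoints but its derivative is only prescribed inside:
    this is what the mean value theorem needs, and it holds both for one-sided
    derivatives on a segment and for indefinite integrals. *)
Definition antiderivative a b f F : Prop :=
  {within `[a, b], continuous F} /\
  forall x, x \in `]a, b[ -> diff_quot F x @ x^' --> f x.

Lemma antiderivative_linear a b f F g G (c : R) :
  antiderivative a b f F -> antiderivative a b g G ->
  antiderivative a b (fun x => f x + c * g x) (fun x => F x + c * G x).
Proof.
move=> [cF dF] [cG dG]; split=> [x|x xab].
  by apply: cvgD; [exact: cF | apply: cvgM; [exact: cvg_cst | exact: cG]].
have -> : diff_quot (fun x => F x + c * G x) x =
    (fun y => diff_quot F x y + c * diff_quot G x y).
  by apply/funext => y; rewrite /diff_quot; ring.
by apply: cvgD; [exact: dF | apply: cvgM; [exact: cvg_cst | exact: dG]].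
Qed.

Lemma antiderivative_cst a b : antiderivative a b (cst 1) id.
Proof.
split=> [|x _]; first by apply: continuous_subspaceT => x; exact: cvg_id.
have : cst (1 : R) y @[y --> x^'] --> (1 : R) by exact: cvg_cst.
apply: cvg_trans; apply: near_eq_cvg.
near=> y; rewrite /diff_quot divff// subr_eq0.
by near: y; exact: nbhs_dnbhs_neq.
Unshelve. all: by end_near. Qed.

Lemma antiderivative_id a b : antiderivative a b id (fun x => x ^+ 2 / 2).
Proof.
split=> [|x _].
  apply: continuous_subspaceT => x.
  by apply: cvgM; [exact: exprn_continuous | exact: cvg_cst].
have : (y + x) / 2 @[y --> x^'] --> (x + x) / 2.
  apply: cvgM; last exact: cvg_cst.
  by apply: cvgD; [exact: cvg_within | exact: cvg_cst].
have -> : (x + x) / 2 = x by field.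
apply: cvg_trans; apply: near_eq_cvg.
near=> y; rewrite /diff_quot.
have : y - x != 0 by rewrite subr_eq0; near: y; exact: nbhs_dnbhs_neq.
by move=> yx; field.
Unshelve. all: by end_near. Qed.

Lemma antiderivative_MVT a b f F x y :
  antiderivative a b f F -> a <= x -> x < y -> y <= b ->
  exists2 c, c \in `]x, y[ & F y - F x = f c * (y - x).
Proof.
move=> [cF dF] ax xy yb.
apply: (@MVT _ F f x y xy) => [t txy|].
  have tab : t \in `]a, b[.
    move: txy; rewrite !in_itv /= => /andP[xt ty].
    by rewrite (le_lt_trans ax xt) (lt_le_trans ty yb).
  have /diff_quot_cvgP dFt := dF _ tab.
  have dFt1 : h^-1 * (F (h *: 1 + t) - F t) @[h --> 0^'] --> f t.
    by under eq_fun do rewrite [_ *: 1]mulr1.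
  apply: DeriveDef; first by apply/cvg_ex; exists (f t); exact: dFt1.
  by apply: cvg_lim; [exact: Rhausdorff | exact: dFt1].
apply: (continuous_subspaceW _ cF).
by apply: subset_itvScc; rewrite bnd_simp.
Qed.

(** The indefinite integral from a, by the fundamental theorem of calculus. *)
Lemma continuous_antiderivative a b f : a < b ->
  {within `[a, b], continuous f} ->
  exists2 F, antiderivative a b f F &
    F b - F a = (\int[@lebesgue_measure R]_(t in `[a, b]) f t)%R.
Proof.
move=> ab cf.
have fi : (@lebesgue_measure R).-integrable `[a, b] (EFin \o f).
  by apply: continuous_compact_integrable => //; exact: segment_compact.
exists (fun x => \int[@lebesgue_measure R]_(t in `[a, x]) f t)%R; last first.
  by rewrite set_itv1 Rintegral_set1 subr0.
split; first exact: (parameterized_integral_continuous (ltW ab) fi).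
move=> x xab; have /andP[ax xb] : a < x < b by move: xab; rewrite in_itv.
have [dF <-] := continuous_FTC1_closed xb fi ax
  (within_continuous_continuous ab cf xab).
exact: derivable_diff_quot dF.
Qed.

(** In the interior the restriction to the segment is not seen by the limit. *)
Lemma derive_in_interior a b f x : x \in `]a, b[ ->
  derivable_in `[a, b] f x -> diff_quot f x @ x^' --> derive_in `[a, b] f x.
Proof.
move=> xab df; apply: cvg_trans df => P Px.
apply: filterS2 (near_in_itvoo xab) Px => y yab Py yx.
exact: Py yx (subset_itv_oo_cc yab).
Qed.

(** * Taylor remainders *)

(** Taylor remainders of order 1 of F, with derivative f, on the segment from x
    to y: at y from the expansion at x, and at x from the expansion at y. *)
Definition fwd_rem (f F : R -> R) x y : R := F y - F x - (y - x) * f x.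
Definition bwd_rem (f F : R -> R) x y : R := F x - F y + (y - x) * f y.

(** If F'' >= 0 then f = F' is nondecreasing, and the increment of F over the
    segment is the length times an intermediate value of f. *)
Lemma remainders_ge0 a b g f F x y :
  antiderivative a b g f -> antiderivative a b f F ->
  (forall t, t \in `]a, b[ -> 0 <= g t) ->
  a <= x -> x < y -> y <= b ->
  0 <= fwd_rem f F x y /\ 0 <= bwd_rem f F x y.
Proof.
move=> gf fF g0 ax xy yb.
have mono s t : a <= s -> s < t -> t <= b -> f s <= f t.
  move=> sa st tb; have [c cst fc] := antiderivative_MVT gf sa st tb.
  rewrite -subr_ge0 fc mulr_ge0 ?subr_ge0 ?(ltW st)// g0//.
  move: cst; rewrite !in_itv /= => /andP[sc ct].
  by rewrite (le_lt_trans sa sc) (lt_le_trans ct tb).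
have [c + Fc] := antiderivative_MVT fF ax xy yb.
rewrite in_itv /= => /andP[xc cy].
have fx : f x <= f c by apply: mono => //; rewrite (le_trans (ltW cy)).
have fy : f c <= f y by apply: mono => //; rewrite (le_trans ax) ?ltW.
by rewrite /fwd_rem /bwd_rem; split; nra.
Qed.

(** The previous lemma for Q0 - m F - c t^2 / 2, whose second derivative
    q - m g - c is nonnegative; both remainders of t^2 / 2 are
    (y - x)^2 / 2. *)
Lemma remainders_affine_lb a b g f F q Q1 Q0 (c m : R) x y :
  antiderivative a b g f -> antiderivative a b f F ->
  antiderivative a b q Q1 -> antiderivative a b Q1 Q0 ->
  (forall t, t \in `]a, b[ -> c + m * g t <= q t) ->
  a <= x -> x < y -> y <= b ->
  c * ((y - x) ^+ 2 / 2) + m * fwd_rem f F x y <= fwd_rem Q1 Q0 x y /\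
  c * ((y - x) ^+ 2 / 2) + m * bwd_rem f F x y <= bwd_rem Q1 Q0 x y.
Proof.
move=> gf fF qQ QQ le_q ax xy yb.
have d2 := antiderivative_linear (- c)
  (antiderivative_linear (- m) qQ gf) (antiderivative_cst a b).
have d1 := antiderivative_linear (- c)
  (antiderivative_linear (- m) QQ fF) (antiderivative_id a b).
have [] := remainders_ge0 d2 d1 _ ax xy yb.
  by move=> t tab; have := le_q t tab; rewrite /=; lra.
by rewrite /fwd_rem /bwd_rem => r1 r2; split; nra.
Qed.

Lemma fwd_remDbwd_rem f F x y :
  fwd_rem f F x y + bwd_rem f F x y = (y - x) * (f y - f x).
Proof. rewrite /fwd_rem /bwd_rem; ring. Qed.

End antiderivatives.

Section powers_and_norms.
Context {R : realType}.
Implicit Types (f g F : R -> R) (a b x y r : R).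

(** * Tangent lines of the p-th power and Jensen's inequality for remainders *)

(** Young's inequality x * 1 <= x^r / r + 1 / q with the conjugate exponent
    q = r / (r - 1). *)
Lemma bernoulli_powR r x : 1 <= r -> 0 <= x -> 1 + r * (x - 1) <= x `^ r.
Proof.
rewrite le_eqVlt => /predU1P[<- x0|r1 x0]; first by rewrite powRr1//; lra.
have r0 : 0 < r by lra.
have q0 : 0 < r / (r - 1) by rewrite divr_gt0// subr_gt0.
have q1 : r^-1 + (r / (r - 1))^-1 = 1.
  by field; rewrite !gt_eqF// subr_gt0.
have := conjugate_powR x0 ler01 r0 q0 q1.
rewrite powR1 mulr1 -(ler_pM2l r0) mulrDr.
have -> : r * (1 / (r / (r - 1))) = r - 1 by field; rewrite !gt_eqF// subr_gt0.
by rewrite mulrCA divff ?gt_eqF// mulr1; lra.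
Qed.

(** Tangent lines of the convex function |t|^r, obtained by homogeneity from
    Bernoulli's inequality at |t / x|. *)
Lemma powR_norm_subgradient r x : 1 <= r ->
  exists m, forall t, `|x| `^ r + m * (t - x) <= `|t| `^ r.
Proof.
move=> r1; have [->|x0] := eqVneq x 0.
  by exists 0 => t; rewrite mul0r addr0 normr0 powR0 ?powR_ge0// gt_eqF//; lra.
exists (r * `|x| `^ r / x) => t.
have -> : `|t| = `|t / x| * `|x| by rewrite -normrM divfK.
rewrite powRM//.
have -> : r * `|x| `^ r / x * (t - x) = `|x| `^ r * (r * (t / x - 1)).
  by field.
rewrite -{1}[_ `^ r]mulr1 -mulrDr [leRHS]mulrC ler_wpM2l ?powR_ge0//.
apply: le_trans (bernoulli_powR r1 (normr_ge0 _)).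
have := ler_norm (t / x); nra.
Qed.

(** Half the sum of the tangent line inequalities at the midpoint, taken at x
    and y. *)
Lemma powR_norm_midpoint r x y : 1 <= r ->
  `|(x + y) / 2| `^ r <= (`|x| `^ r + `|y| `^ r) / 2.
Proof.
move=> r1; have [m hm] := @powR_norm_subgradient r ((x + y) / 2) r1.
have := hm x; have := hm y; lra.
Qed.

(** Jensen's inequality: with d = (y - x)^2, the remainder R of F is d / 2 times
    a mean of g, and the remainder of Q0 is d / 2 times the same mean of |g|^r;
    the tangent line at the mean 2 R / d of g compares the two. *)
Lemma remainders_powR_le a b g f F r Q1 Q0 x y : 1 <= r ->
  antiderivative a b g f -> antiderivative a b f F ->
  antiderivative a b (fun t => `|g t| `^ r) Q1 -> antiderivative a b Q1 Q0 ->
  a <= x -> x < y -> y <= b ->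
  let K := ((y - x) ^+ 2) `^ r * (2 / (y - x) ^+ 2) in
  `|2 * fwd_rem f F x y| `^ r <= K * fwd_rem Q1 Q0 x y /\
  `|2 * bwd_rem f F x y| `^ r <= K * bwd_rem Q1 Q0 x y.
Proof.
move=> r1 gf fF gQ QQ ax xy yb K.
have d0 : 0 < (y - x) ^+ 2 by rewrite exprn_gt0// subr_gt0.
(* Both remainders satisfy the same family of affine bounds, and nothing else
   about them is used. *)
have key (A B : R) : (forall c m : R,
    (forall t, t \in `]a, b[ -> c + m * g t <= `|g t| `^ r) ->
    c * ((y - x) ^+ 2 / 2) + m * A <= B) -> `|2 * A| `^ r <= K * B.
  rewrite {}/K; move: d0; move: ((y - x) ^+ 2) => d d0 H.
  have [m hm] := @powR_norm_subgradient r (2 * A / d) r1.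
  have /H : forall t, t \in `]a, b[ ->
      `|2 * A / d| `^ r - m * (2 * A / d) + m * g t <= `|g t| `^ r.
    by move=> t _; have := hm (g t); lra.
  have -> : `|2 * A| = d * `|2 * A / d|.
    by rewrite -[X in X * `|_|](gtr0_norm d0) -normrM [d * _]mulrC divfK// gt_eqF.
  move=> le_B; rewrite powRM ?(ltW d0)// -[leRHS]mulrA.
  rewrite ler_wpM2l ?powR_ge0// [leRHS]mulrC -ler_pdivrMr ?divr_gt0//.
  apply: le_trans le_B; rewrite le_eqVlt; apply/orP; left; apply/eqP.
  by field; rewrite gt_eqF.
by split; apply: key => c m h;
  have [] := remainders_affine_lb gf fF gQ QQ h ax xy yb.
Qed.

(** The affine lower bounds -M <= g and 2 g - M <= g of g by itself give the
    two signs. *)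
Lemma remainders_norm_le a b g f F (M : R) x y :
  antiderivative a b g f -> antiderivative a b f F ->
  (forall t, t \in `]a, b[ -> `|g t| <= M) ->
  a <= x -> x < y -> y <= b ->
  `|fwd_rem f F x y| <= M * ((y - x) ^+ 2 / 2) /\
  `|bwd_rem f F x y| <= M * ((y - x) ^+ 2 / 2).
Proof.
move=> gf fF gM ax xy yb.
have [] := @remainders_affine_lb _ a b g f F g f F (- M) 0 _ _ gf fF gf fF _ ax xy yb.
  by move=> t /gM; rewrite ler_norml; lra.
have [] := @remainders_affine_lb _ a b g f F g f F (- M) 2 _ _ gf fF gf fF _ ax xy yb.
  by move=> t /gM; rewrite ler_norml; lra.
rewrite !ler_norml => *; split; lra.
Qed.

(** * Lebesgue norms of continuous functions *)

(** Away from 0 the function is expR (r * ln |x|); at 0 it is squeezed between 0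
    and |x|, since r >= 1. *)
Lemma powR_norm_continuous r : 1 <= r -> continuous (fun x : R => `|x| `^ r).
Proof.
move=> r1 x; have [->|x0] := eqVneq x 0; last first.
  have : expR (r * ln `|y|) @[y --> x] --> expR (r * ln `|x|).
    apply: continuous_comp; last exact: continuous_expR.
    apply: cvgM; first exact: cvg_cst.
    apply: (@continuous_comp _ _ _ (fun y : R => `|y|) (@ln R)); first exact: norm_continuous.
    by apply: continuous_ln; rewrite normr_gt0.
  rewrite /continuous_at {2}/powR normr_eq0 (negbTE x0).
  apply: cvg_trans; apply: near_eq_cvg; near=> y.
  rewrite /powR normr_eq0 ifF//; apply/negbTE.
  near: y; exact: open_neq.
rewrite /continuous_at normr0 powR0; last by rewrite gt_eqF//; lra.
apply: (@squeeze_cvgr _ _ _ _ (cst 0) (fun y : R => `|y|)); last 2 first.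
- exact: cvg_cst.
- by rewrite -[X in _ --> X](@normr0 R R); exact: norm_continuous.
near=> y; rewrite powR_ge0 /=.
have y1 : `|y| <= 1.
  near: y; exists 1 => //= z.
  by rewrite /ball /= sub0r normrN => /ltW.
have [->|y0] := eqVneq y 0; first by rewrite normr0 powR0// gt_eqF//; lra.
rewrite -[leRHS](powRr1 (normr_ge0 _)) ger_powR//.
by rewrite normr_gt0 y0.
Unshelve. all: by end_near. Qed.

Lemma within_powR_norm_continuous (A : set R) r g : 1 <= r ->
  {within A, continuous g} -> {within A, continuous (fun t => `|g t| `^ r)}.
Proof.
move=> r1 cg x; have cx := @powR_norm_continuous r r1 (g x).
exact: (@continuous_comp _ _ _ (g : subspace A -> R) (fun y => `|y| `^ r) x (cg x) cx).
Qed.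

(** If g t > M then g > M on a ball around t, which has positive measure. *)
Lemma le_ae_itv a b g (M : R) : a < b -> {within `[a, b], continuous g} ->
  {ae @lebesgue_measure R, forall t, t \in `]a, b[ -> g t <= M} ->
  forall t, t \in `]a, b[ -> g t <= M.
Proof.
move=> ab cg [N [mN N0 subN]] t tab; rewrite leNgt; apply/negP => Mgt.
have cgt := within_continuous_continuous ab cg tab.
have [e /= e0 eN] : \forall z \near t, N z.
  apply: filterS2 (near_in_itvoo tab) (cvgr_gt _ cgt _ Mgt) => z zab Mz.
  by apply: subN => /= /(_ zab); rewrite leNgt Mz.
have : (@lebesgue_measure R (ball t e) <= 0)%E.
  rewrite -N0; apply: le_measure; rewrite ?inE//.
  exact: measurable_ball.
by rewrite lebesgue_measure_ball ?(ltW e0)// lee_fin leNgt pmulrn_lgt0// e0.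
Qed.

Lemma LpNorm_fin a b r g : 1 <= r -> {within `[a, b], continuous g} ->
  LpNorm `[a, b] r%:E g =
  ((\int[@lebesgue_measure R]_(t in `[a, b]) (`|g t| `^ r)) `^ r^-1)%:E.
Proof.
move=> r1 cg; rewrite /LpNorm unlock -poweR_EFin; congr (_ `^ _)%E.
have gi : (@lebesgue_measure R).-integrable `[a, b]
    (EFin \o (fun t => `|g t| `^ r)).
  have cgr := within_powR_norm_continuous r1 cg.
  by apply: continuous_compact_integrable => //; exact: segment_compact.
rewrite fineK; last exact: integrable_fin_num gi.
rewrite [RHS]integral_mkcond; apply: eq_integral => t _.
rewrite /= patchE [RHS]patchE; case: ifPn => // _.
by rewrite [LHS](_ : _ = (`|0 : R| `^ r)%:E)// normr0 powR0// gt_eqF//; lra.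
Qed.

Lemma LpNorm_pinfty a b g (M : R) : a < b -> {within `[a, b], continuous g} ->
  (LpNorm `[a, b] +oo g <= M%:E)%E ->
  forall t, t \in `]a, b[ -> `|g t| <= M.
Proof.
move=> ab cg; rewrite /LpNorm unlock ifT; last first.
  apply: (@lt_le_trans _ _ (@lebesgue_measure R (ball 0 1))).
    by rewrite lebesgue_measure_ball// lte_fin pmulrn_lgt0.
  by apply: le_measure; rewrite ?inE//; exact: measurable_ball.
move=> /ess_supP gM; apply: (le_ae_itv ab) => [x|].
  exact: cvg_norm (cg x).
apply: filterS gM => t /= + tab.
by rewrite patchE mem_set ?lee_fin//; exact: subset_itv_oo_cc tab.
Qed.

End powers_and_norms.

Section discrete_profile.
Context {R : realType}.
Implicit Types (f g F : R -> R) (a b x y r : R) (v : int -> R) (i : int) (n k : nat).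

(** * Second differences of the sampled profile *)

Lemma mem_int_range i k (xi : int) :
  (xi \in int_range i k) = (i <= xi <= i + k%:Z).
Proof.
apply/imfsetP/idP => [[n + ->]|/andP[ix xk]].
  by rewrite [_ \in _]mem_iota; lia.
by exists `|xi - i|%N; [rewrite [_ \in _]mem_iota; lia | lia].
Qed.

Lemma big_int_range i k v :
  \sum_(xi <- int_range i k) v xi = \sum_(n < k.+1) v (i + n%:Z).
Proof.
have injn : injective (fun n : nat => i + n%:Z) by move=> m n; lia.
rewrite -(big_mkord xpredT (fun n => v (i + n%:Z))).
rewrite -(big_map (fun n : nat => i + n%:Z) xpredT v).
apply: perm_big; apply: uniq_perm; rewrite ?map_inj_uniq ?iota_uniq ?fset_uniq//.
move=> xi; rewrite mem_int_range; apply/idP/mapP => [h|[n + ->]].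
  by exists `|xi - i|%N; [rewrite [_ \in _]mem_iota; lia | lia].
by rewrite [_ \in _]mem_iota; lia.
Qed.

(** The sampling points, in the coordinate of the profile. *)
Definition node k n : R := n%:R / k%:R.

Lemma node_in01 k n : (n <= k)%N -> 0 <= node k n <= 1.
Proof.
case: k => [|k nk]; first by rewrite /node invr0 mulr0 lexx ler01.
by rewrite divr_ge0// ler_pdivrMr ?ltr0n// mul1r ler_nat.
Qed.

Lemma nodeS k n : node k n.+1 - node k n = k%:R^-1.
Proof. by rewrite /node -mulrBl -natrB// subSnn mul1r. Qed.

Lemma ler_bigmax_fset (J : {fset int}) v (xi : int) : xi \in J ->
  v xi <= \big[Num.max/0]_(x <- J) v x.
Proof. by move=> xiJ; apply: le_bigmax_seq. Qed.

(** The sequence u preceded by 0; it lets the cell on the left of a node be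
    indexed by the node itself, the leftmost node having no such cell. *)
Definition delayed (u : nat -> R) n : R := if n is m.+1 then u m else 0.

Lemma sum_delayed k (u : nat -> R) :
  \sum_(n < k.+1) delayed u n = \sum_(n < k) u n.
Proof. by rewrite big_ord_recl add0r. Qed.

Section sampled_profile.
Variables (gamma : R -> R) (i : int) (k : nat).
Hypotheses (k_gt0 : (0 < k)%N) (gamma0 : gamma 0 = 0) (gamma1 : gamma 1 = 1).

Lemma gammaJ_node n : (n <= k)%N -> gammaJ gamma i k (i + n%:Z) = gamma (node k n).
Proof.
move=> nk; have /andP[n0 n1] := node_in01 nk.
rewrite /gammaJ /extend01 addrAC subrr add0r -[_%:~R / _]/(node k n).
by rewrite ltNge n0 ltNge n1.
Qed.

Lemma gammaJ_left (xi : int) : xi <= i -> gammaJ gamma i k xi = 0.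
Proof.
move=> xii; have k0 : 0 < k%:R :> R by rewrite ltr0n.
have [->|xi_lt] := eqVneq xi i.
  by have := gammaJ_node (leq0n k); rewrite addr0 /node mul0r gamma0.
rewrite /gammaJ /extend01 pmulr_llt0 ?invr_gt0// ltrz0 ifT//; lia.
Qed.

Lemma gammaJ_right (xi : int) : i + k%:Z <= xi -> gammaJ gamma i k xi = 1.
Proof.
move=> xik; have k0 : 0 < k%:R :> R by rewrite ltr0n.
have [->|xi_gt] := eqVneq xi (i + k%:Z).
  by rewrite gammaJ_node// /node divff// gt_eqF.
rewrite /gammaJ /extend01 ltNge divr_ge0 ?ler0z ?(ltW k0)//=; last lia.
rewrite ltr_pdivlMr// mul1r -[k%:R]/(k%:~R) ltr_int ifT//; lia.
Qed.

Lemma Delta2_gammaJ_left : Delta2 (gammaJ gamma i k) (i - 1) = 0.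
Proof. by rewrite /Delta2 !gammaJ_left; [ring | lia..]. Qed.

Lemma Delta2_gammaJ_bar xi : Delta2 (gammaJ_bar gamma i k) xi =
  (Delta2 (gammaJ gamma i k) xi + Delta2 (gammaJ gamma i k) (xi - 1)) / 2.
Proof.
rewrite /Delta2 /gammaJ_bar.
have -> : xi + 1 - 1 = xi by lia.
have -> : xi - 1 + 1 = xi by lia.
by field.
Qed.

Lemma ell_norm_gammaJ_bar_le eps p : 0 < eps -> (1 <= p)%E ->
  ell_norm eps p (int_range i k) (Delta2 (gammaJ_bar gamma i k)) <=
  ell_norm eps p (int_range i k) (Delta2 (gammaJ gamma i k)).
Proof.
move=> eps0; pose D := Delta2 (gammaJ gamma i k).
case: p => [r r1||_].
- rewrite lee_fin in r1; rewrite /ell_norm.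
  have ri0 : 0 <= r^-1 by rewrite invr_ge0; lra.
  have r0 : r != 0 by rewrite gt_eqF//; lra.
  rewrite !big_int_range ge0_ler_powR ?nnegrE//.
  - by rewrite mulr_ge0 ?(ltW eps0)// sumr_ge0// => n _; exact: powR_ge0.
  - by rewrite mulr_ge0 ?(ltW eps0)// sumr_ge0// => n _; exact: powR_ge0.
  rewrite ler_pM2l//.
  pose u n := `|D (i + n%:Z)| `^ r.
  have u0 n : 0 <= u n by exact: powR_ge0.
  apply: (@le_trans _ _
    (\sum_(n < k.+1) (u n + delayed u n) / 2)).
    apply: ler_sum => -[[|n] nk] _ /=; rewrite Delta2_gammaJ_bar.
      apply: le_trans (powR_norm_midpoint _ _ r1) _.
      have -> : i + 0%N%:Z - 1 = i - 1 by lia.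
      by rewrite Delta2_gammaJ_left normr0 powR0.
    apply: le_trans (powR_norm_midpoint _ _ r1) _.
    by have -> : i + n.+1%:Z - 1 = i + n%:Z by lia.
  suff : \sum_(n < k.+1) (u n + delayed u n) / 2 <= \sum_(n < k.+1) u n by [].
  by rewrite -mulr_suml big_split /= sum_delayed big_ord_recr /=; have := u0 k; lra.
- move=> _; rewrite /ell_norm [leLHS]big_seq.
  set M := (X in _ <= X).
  have M0 : 0 <= M by exact: bigmax_ge_id.
  have DM xi : xi \in int_range i k -> `|D xi| <= M.
    exact: ler_bigmax_fset (fun xi => `|D xi|) _.
  apply: bigmax_le => // xi xiJ; rewrite Delta2_gammaJ_bar -/D.
  have DM' : `|D (xi - 1)| <= M.
    have [->|xi_i] := eqVneq xi i.
      by rewrite /D Delta2_gammaJ_left normr0.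
    by apply: DM; move: xiJ; rewrite !mem_int_range; lia.
  rewrite normrM [X in _ * X]ger0_norm//.
  by have := ler_normD (D xi) (D (xi - 1)); have := DM _ xiJ; lra.
- exact: lexx.
Qed.

(** The slopes at a node cancel between the two remainders.  At n = 0 and n = k
    the missing remainder is that of the constant extension of the profile,
    which is consistent because the profile has zero slope there. *)
Lemma Delta2_gammaJ_remainders gamma' n : gamma' 0 = 0 -> gamma' 1 = 0 ->
  (n <= k)%N ->
  Delta2 (gammaJ gamma i k) (i + n%:Z) =
    (if (n < k)%N then fwd_rem gamma' gamma (node k n) (node k n.+1) else 0) +
    delayed (fun m => bwd_rem gamma' gamma (node k m) (node k m.+1)) n.
Proof.
move=> d0 d1 nk; rewrite /Delta2 gammaJ_node//.
have e1 : i + n%:Z + 1 = i + n.+1%:Z by lia.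
have nk1 : (n < k)%N = false -> node k n = 1.
  by move=> nk'; have -> : n = k; [lia | rewrite /node divff// pnatr_eq0; lia].
have n0 : node k 0 = 0 by rewrite /node mul0r.
rewrite e1; case nk' : (n < k)%N; [rewrite gammaJ_node// | rewrite gammaJ_right; last lia].
  case: n nk nk' nk1 e1 => [|m] nk nk' nk1 e1.
    rewrite gammaJ_left; last lia.
    by rewrite /fwd_rem /= n0 gamma0 d0; ring.
  have -> : i + m.+1%:Z - 1 = i + m%:Z by lia.
  rewrite gammaJ_node; last lia.
  by rewrite /fwd_rem /= /bwd_rem !nodeS; ring.
case: n nk nk' nk1 e1 => [|m] nk nk' nk1 e1; first lia.
have -> : i + m.+1%:Z - 1 = i + m%:Z by lia.
rewrite gammaJ_node; last lia.
by rewrite /= /bwd_rem nk1// gamma1 d1; ring.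
Qed.

Section second_difference_bounds.
Variables g gamma' : R -> R.
Hypotheses (ggamma' : antiderivative 0 1 g gamma')
  (gamma'gamma : antiderivative 0 1 gamma' gamma)
  (gamma'0 : gamma' 0 = 0) (gamma'1 : gamma' 1 = 0).

Let cell n : (n < k)%N ->
  [/\ 0 <= node k n, node k n < node k n.+1 & node k n.+1 <= 1].
Proof.
move=> nk; have /andP[n0 _] := node_in01 (ltnW nk).
have /andP[_ n1] := node_in01 nk.
by split=> //; rewrite -subr_gt0 nodeS invr_gt0 ltr0n.
Qed.

(** The second difference is the mean of twice its two remainders; bounding
    each by the remainder of Q0 on its cell, every cell is used once in each
    direction, and the two remainders of Q0 on a cell add up to an increment of
    Q1, so that the sum telescopes. *)
Lemma sum_Delta2_powR_le r Q1 Q0 : 1 <= r ->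
  antiderivative 0 1 (fun t => `|g t| `^ r) Q1 -> antiderivative 0 1 Q1 Q0 ->
  \sum_(n < k.+1) `|Delta2 (gammaJ gamma i k) (i + n%:Z)| `^ r <=
    (k%:R^-1 ^+ 2) `^ r * k%:R * (Q1 1 - Q1 0).
Proof.
move=> r1 gQ QQ; have k0 : 0 < k%:R :> R by rewrite ltr0n.
pose K : R := (k%:R^-1 ^+ 2) `^ r * (2 / k%:R^-1 ^+ 2).
pose U n := fwd_rem Q1 Q0 (node k n) (node k n.+1).
pose V n := bwd_rem Q1 Q0 (node k n) (node k n.+1).
have UV n : (n < k)%N ->
    `|2 * fwd_rem gamma' gamma (node k n) (node k n.+1)| `^ r <= K * U n /\
    `|2 * bwd_rem gamma' gamma (node k n) (node k n.+1)| `^ r <= K * V n.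
  move=> /cell[n0 nn n1].
  by have := remainders_powR_le r1 ggamma' gamma'gamma gQ QQ n0 nn n1; rewrite nodeS.
have zr : `|2 * 0 : R| `^ r = 0 by rewrite mulr0 normr0 powR0// gt_eqF//; lra.
apply: (@le_trans _ _
  (\sum_(n < k.+1) ((if (n < k)%N then K * U n else 0) +
                    delayed (fun m => K * V m) n) / 2)).
  apply: ler_sum => -[n /= nk] _; rewrite (Delta2_gammaJ_remainders gamma'0 gamma'1)//.
  set A := (X in X + _); set B := (X in _ + X).
  have -> : A + B = (2 * A + 2 * B) / 2 by field.
  apply: le_trans (powR_norm_midpoint _ _ r1) _.
  rewrite ler_pM2r// lerD// /A /B.
    by case: ifPn => [/UV[]//|_]; rewrite zr.
  by case: n nk {A B} => [|n] nk /=; [rewrite zr | case: (UV n nk)].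
rewrite -mulr_suml big_split /= sum_delayed big_ord_recr /= ltnn addr0.
under eq_bigr => n _ do rewrite ltn_ord.
rewrite -big_split /=.
under eq_bigr => n _ do rewrite -mulrDr /U /V fwd_remDbwd_rem nodeS.
rewrite -mulr_sumr -mulr_sumr -(big_mkord xpredT (fun n => Q1 (node k n.+1) - Q1 (node k n))).
rewrite telescope_sumr//.
have -> : node k k = 1 by rewrite /node divff// gt_eqF.
have -> : node k 0 = 0 by rewrite /node mul0r.
rewrite le_eqVlt; apply/orP; left; apply/eqP; rewrite /K.
by field; rewrite gt_eqF.
Qed.

Lemma Delta2_norm_le (M : R) (xi : int) :
  (forall t, t \in `]0, 1[ -> `|g t| <= M) -> xi \in int_range i k ->
  `|Delta2 (gammaJ gamma i k) xi| <= k%:R^-1 ^+ 2 * M.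
Proof.
move=> gM; rewrite mem_int_range => xiJ.
have M0 : 0 <= M.
  by apply: le_trans (gM (2^-1) _); rewrite ?normr_ge0// in_itv /=; apply/andP; split; lra.
have [n -> nk] : exists2 n, xi = i + n%:Z & (n <= k)%N.
  by exists `|xi - i|%N; lia.
pose e := k%:R^-1 ^+ 2 * M / 2.
have e0 : 0 <= e by rewrite /e !mulr_ge0// ?invr_ge0// ?exprn_ge0// invr_ge0.
have cellM m : (m < k)%N ->
    `|fwd_rem gamma' gamma (node k m) (node k m.+1)| <= e /\
    `|bwd_rem gamma' gamma (node k m) (node k m.+1)| <= e.
  move=> /cell[m0 mm m1].
  have := remainders_norm_le ggamma' gamma'gamma gM m0 mm m1; rewrite nodeS.
  by have -> : M * (k%:R^-1 ^+ 2 / 2) = e by rewrite /e; ring.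
rewrite (Delta2_gammaJ_remainders gamma'0 gamma'1)//; apply: le_trans (ler_normD _ _) _.
have -> : k%:R^-1 ^+ 2 * M = e + e by rewrite /e; field; rewrite pnatr_eq0; lia.
rewrite lerD//; first by case: ifPn => [/cellM[]//|_]; rewrite normr0.
by case: n nk {xiJ} => [|n] nk /=; [rewrite normr0 | case: (cellM n nk)].
Qed.

End second_difference_bounds.
End sampled_profile.

(** With h = 1/k, the factor (h^2)^r comes from the second differences and the
    factor k from the density of the nodes. *)
Lemma step_scaling_powR k r : (0 < k)%N -> r != 0 ->
  ((k%:R^-1 ^+ 2) `^ r * k%:R) `^ r^-1 = k%:R `^ (r^-1 - 2) :> R.
Proof.
move=> k0 r0; have kR : 0 < k%:R :> R by rewrite ltr0n.
have -> : k%:R^-1 ^+ 2 = k%:R `^ (- 2) :> R.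
  by rewrite powR_invn ?(ltW kR)// exprVn.
rewrite -powRrM -[X in _ * X](powRr1 (ltW kR)) -powRD; last first.
  by rewrite (gt_eqF kR) implybT.
by rewrite -powRrM; congr (_ `^ _); field.
Qed.

End discrete_profile.

(** * The two inequalities *)

Theorem mainTheorem6 (R : realType) (eps : R) (k : nat) (i : int)
    (gamma_s : R -> R) :
  0 < eps ->
  (1 <= k)%N ->
  (forall x : R, 0 <= x <= 1 -> 0 <= gamma_s x <= 1) ->
  C2_in `[0, 1] gamma_s ->
  gamma_s 0 = 0 ->
  gamma_s 1 = 1 ->
  derive_in `[0, 1] gamma_s 0 = 0 ->
  derive_in `[0, 1] gamma_s 1 = 0 ->
  forall p : \bar R, (1 <= p)%E ->
    ell_norm eps p (int_range i k) (Delta2 (gammaJ_bar gamma_s i k))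
      <= ell_norm eps p (int_range i k) (Delta2 (gammaJ gamma_s i k)) /\
    ((ell_norm eps p (int_range i k) (Delta2 (gammaJ gamma_s i k)))%:E
      <= (eps `^ (inv_exponent p) * k%:R `^ (inv_exponent p - 2))%R%:E
         * LpNorm `[0%R, 1%R] p (derive2_in `[0%R, 1%R] gamma_s))%E.
Proof.
move=> eps0 k0 _ [d1 d2 c0 c1 c2] g0 g1 g'0 g'1 p p1.
split; first exact: ell_norm_gammaJ_bar_le.
have kR : 0 < k%:R :> R by rewrite ltr0n.
have in01 x : x \in `]0, 1[ -> x \in (`[0, 1]%classic : set R).
  by move=> x01; rewrite inE; exact: subset_itv_oo_cc x01.
have A1 : antiderivative 0 1 (derive_in `[0, 1] gamma_s) gamma_s.
  by split=> // x x01; apply: derive_in_interior => //; apply: d1; exact: in01.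
have A2 : antiderivative 0 1 (derive2_in `[0, 1] gamma_s) (derive_in `[0, 1] gamma_s).
  by split=> // x x01; apply: derive_in_interior => //; apply: d2; exact: in01.
case: p p1 => [r r1||].
- rewrite lee_fin in r1; rewrite LpNorm_fin// -EFinM lee_fin.
  have r0 : r != 0 by rewrite gt_eqF//; lra.
  (* Q1 1 - Q1 0 is the integral in the norm; Q0 is the function whose second
     derivative is |g|^r. *)
  have [Q1 gQ <-] := continuous_antiderivative ltr01 (within_powR_norm_continuous r1 c2).
  have [Q0 QQ _] := continuous_antiderivative ltr01 gQ.1.
  have := @sum_Delta2_powR_le _ gamma_s i k k0 g0 g1 _ _ A2 A1 g'0 g'1 r Q1 Q0 r1 gQ QQ.
  rewrite /ell_norm big_int_range /=; set S := (X in X <= _) => leS.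
  have S0 : 0 <= S by apply: sumr_ge0 => n _; exact: powR_ge0.
  have h0 : 0 < (k%:R^-1 ^+ 2) `^ r * k%:R :> R.
    by rewrite mulr_gt0// powR_gt0// exprn_gt0// invr_gt0.
  have Q0' : 0 <= Q1 1 - Q1 0 by rewrite -(pmulr_rge0 _ h0) (le_trans S0).
  rewrite -step_scaling_powR// -!powRM// ?(ltW eps0)// ?mulr_ge0 ?(ltW eps0) ?(ltW h0)//.
  rewrite -mulrA ge0_ler_powR ?nnegrE ?invr_ge0 ?mulr_ge0 ?(ltW eps0) ?(ltW h0)//.
    by lra.
  by rewrite ler_pM2l.
- move=> _; rewrite /= powRr0 mul1r sub0r powR_invn ?(ltW kR)//.
  have h0 : 0 < k%:R ^- 2 :> R by rewrite invr_gt0 exprn_gt0.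
  have L0 : (0 <= LpNorm `[0%R, 1%R] +oo (derive2_in `[0%R, 1%R] gamma_s))%E.
    exact: Lnorm_ge0.
  case LM : (LpNorm _ _ _) L0 => [M||] //= M0; last first.
    by rewrite gt0_muley ?leey// lte_fin.
  rewrite -EFinM lee_fin.
  rewrite big_seq; apply: bigmax_le => [|xi xiJ].
    by rewrite mulr_ge0 ?(ltW h0)// -lee_fin.
  rewrite -exprVn; apply: (Delta2_norm_le k0 g0 g1 A2 A1 g'0 g'1) => //.
  by apply: LpNorm_pinfty => //; rewrite LM.
- by [].
Qed.
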